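(* For any natural number $n$, there exists a diagram $D$ of a trivial $2$-component link such that transforming $D$ into a trivial diagram requires at least $n$ R$\mathrm{III}\alpha$ moves; that is, every sequence of Reidemeister moves transforming $D$ into a trivial diagram contains at least $n$ moves of type R$\mathrm{III}\alpha$.
   Context: A diagram of a link is a regular projection of the link onto $S^2$ or $\mathbb{R}^2$ whose intersections are transverse double points with over/under information. RI, RII, RIII denote the usual three types of Reidemeister moves. A trivial diagram of an $r$-component link is a diagram with no (self or non-self) crossings; a trivial link is one admitting a trivial diagram. Natural numbers are $n\ge 1$. The three segments in an RIII move are: the upper segment (over the other two), the middle segment (under the upper and over the lower), and the lower segment (under the other two). An RIII move is an R$\mathrm{III}\alpha$ move if the upper and middle segments belong to different link components and the middle and lower segments belong to different link components (the upper and lower segments may belong to the same or different components). *)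

(* Defs.v *)
From mathcomp Require Import all_boot.
From Stdlib Require Import Relations.

Set Implicit Arguments.
Unset Strict Implicit.
Unset Printing Implicit Defensive.

(* Link diagrams are handled through their height function.  After a small
   isotopy of the plane, the local maxima, local minima and crossings of a
   diagram have pairwise distinct heights.  The diagram is then recorded as the
   list of these events, read from top to bottom, each with the number [i] of
   strands passing to its left.  A maximum creates the strands i and i.+1, a
   minimum joins them and a crossing exchanges them.  In [Crossing b] the strand
   going from upper left to lower right is the over-strand iff [b] is true. *)
Inductive event := Maximum | Minimum | Crossing (b : bool).

Inductive slice := At (e : event) (i : nat).

Definition strands_in (e : event) := if e is Maximum then 0 else 2.
Definition strands_out (e : event) := if e is Minimum then 0 else 2.

(* [width m w]: number of strands below [w] when m strands enter at the top,
   or [None] if some event of [w] lacks the strands it needs. *)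
Fixpoint width (m : nat) (w : seq slice) : option nat :=
  if w is At e i :: w' then
    if i + strands_in e <= m then width (m - strands_in e + strands_out e) w'
    else None
  else Some m.

Record diagram := Diagram {
  slices :> seq slice;
  closed_slices : width 0 slices = Some 0
}.

Definition is_crossing (s : slice) :=
  if s is At (Crossing _) _ then true else false.

Definition trivial_diagram (D : diagram) : Prop := ~~ has is_crossing D.

(* The point (k, j) lies on the strand number j of the horizontal line just
   below the first k events. *)
Definition point := (nat * nat)%type.

Definition is_point (w : seq slice) (p : point) : Prop :=
  exists2 m, width 0 (take p.1 w) = Some m & p.2 < m.

Inductive arc (w : seq slice) : point -> point -> Prop :=
| arc_left k e i j : onth w k = Some (At e i) -> j < i ->
    arc w (k, j) (k.+1, j)
| arc_right k e i j : onth w k = Some (At e i) -> i + strands_in e <= j ->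
    arc w (k, j) (k.+1, j - strands_in e + strands_out e)
| arc_maximum k i : onth w k = Some (At Maximum i) ->
    arc w (k.+1, i) (k.+1, i.+1)
| arc_minimum k i : onth w k = Some (At Minimum i) ->
    arc w (k, i) (k, i.+1)
| arc_falling k b i : onth w k = Some (At (Crossing b) i) ->
    arc w (k, i) (k.+1, i.+1)
| arc_rising k b i : onth w k = Some (At (Crossing b) i) ->
    arc w (k, i.+1) (k.+1, i).

Definition same_component (w : seq slice) : point -> point -> Prop :=
  clos_refl_sym_trans point (arc w).

Definition has_components (D : diagram) (r : nat) : Prop :=
  exists rep : 'I_r -> point,
    [/\ forall a, is_point D (rep a),
        forall a b, same_component D (rep a) (rep b) -> a = b
      & forall p, is_point D p -> exists a, same_component D p (rep a)].

Inductive surface := Sphere | Plane.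

Definition shift_slice (s : slice) := let: At e i := s in At e i.+1.

(* Isotopies that keep all heights distinct and create no critical point do not
   change the list of events.  A generic planar isotopy meets in addition
   finitely many of the following: two distant events exchange heights, a
   maximum and a minimum are born or cancel, a strand becomes horizontal at a
   crossing. *)
Inductive planar_isotopy : seq slice -> seq slice -> Prop :=
| iso_exchange e i e' j : i + strands_in e <= j ->
    planar_isotopy [:: At e' j; At e i]
                   [:: At e i; At e' (j - strands_in e + strands_out e)]
| iso_cancel_left i : planar_isotopy [:: At Maximum i; At Minimum i.+1] [::]
| iso_cancel_right i : planar_isotopy [:: At Maximum i.+1; At Minimum i] [::]
| iso_turn_maximum b i :
    planar_isotopy [:: At Maximum i; At (Crossing b) i.+1]
                   [:: At Maximum i.+1; At (Crossing (~~ b)) i]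
| iso_turn_minimum b i :
    planar_isotopy [:: At (Crossing b) i.+1; At Minimum i]
                   [:: At (Crossing (~~ b)) i; At Minimum i.+1].

(* By an isotopy of the disc supporting it, a Reidemeister move can be put in
   one of the positions below. *)
Inductive reidemeister1 : seq slice -> seq slice -> Prop :=
| r1_maximum b i :
    reidemeister1 [:: At Maximum i; At (Crossing b) i] [:: At Maximum i]
| r1_minimum b i :
    reidemeister1 [:: At (Crossing b) i; At Minimum i] [:: At Minimum i].

Inductive reidemeister2 : seq slice -> seq slice -> Prop :=
| r2 b i :
    reidemeister2 [:: At (Crossing b) i; At (Crossing (~~ b)) i] [::].

(* In a third Reidemeister move the strands entering at the positions i, i.+1
   and i.+2 are numbered 0, 1 and 2, and [h] lists these numbers from the upper
   strand to the lower one. *)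
Definition above (h : seq nat) (a b : nat) := index a h < index b h.

Definition r3_before (h : seq nat) (i : nat) :=
  [:: At (Crossing (above h 0 1)) i;
      At (Crossing (above h 0 2)) i.+1;
      At (Crossing (above h 1 2)) i].

Definition r3_after (h : seq nat) (i : nat) :=
  [:: At (Crossing (above h 1 2)) i.+1;
      At (Crossing (above h 0 2)) i;
      At (Crossing (above h 0 1)) i.+1].

Inductive move_type := Isotopy | RI | RII | RIIIalpha | RIIIother.

Definition is_RIIIalpha (t : move_type) :=
  if t is RIIIalpha then true else false.

Definition alpha_condition (w : seq slice) (k i upper middle lower : nat) : Prop :=
  ~ same_component w (k, i + upper) (k, i + middle) /\
  ~ same_component w (k, i + middle) (k, i + lower).

Inductive directed_move (S : surface) : move_type -> seq slice -> seq slice -> Prop :=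
| move_isotopy u v x y : planar_isotopy x y ->
    directed_move S Isotopy (u ++ x ++ v) (u ++ y ++ v)
(* An arc adjacent to the unbounded region is pushed through the point at
   infinity, from the left of the rest of the diagram to its right. *)
| move_infinity w : S = Sphere -> width 1 w = Some 1 ->
    directed_move S Isotopy
      (At Maximum 0 :: map shift_slice w ++ [:: At Minimum 0])
      (At Maximum 0 :: w ++ [:: At Minimum 0])
| move_RI u v x y : reidemeister1 x y ->
    directed_move S RI (u ++ x ++ v) (u ++ y ++ v)
| move_RII u v x y : reidemeister2 x y ->
    directed_move S RII (u ++ x ++ v) (u ++ y ++ v)
| move_RIIIalpha u v i upper middle lower (h := [:: upper; middle; lower]) :
    perm_eq h [:: 0; 1; 2] ->
    alpha_condition (u ++ r3_before h i ++ v) (size u) i upper middle lower ->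
    directed_move S RIIIalpha (u ++ r3_before h i ++ v) (u ++ r3_after h i ++ v)
| move_RIIIother u v i upper middle lower (h := [:: upper; middle; lower]) :
    perm_eq h [:: 0; 1; 2] ->
    ~ alpha_condition (u ++ r3_before h i ++ v) (size u) i upper middle lower ->
    directed_move S RIIIother (u ++ r3_before h i ++ v) (u ++ r3_after h i ++ v).

Definition move (S : surface) (t : move_type) (D E : diagram) : Prop :=
  directed_move S t D E \/ directed_move S t E D.

Inductive transforms (S : surface) : diagram -> seq move_type -> diagram -> Prop :=
| transforms_nil D : transforms S D [::] D
| transforms_cons D t E ts F :
    move S t D E -> transforms S E ts F -> transforms S D (t :: ts) F.

Definition same_link (S : surface) (D E : diagram) : Prop :=
  exists ts, transforms S D ts E.

Definition trivial_link (S : surface) (D : diagram) : Prop :=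
  exists2 E, trivial_diagram E & same_link S D E.

(* Main.v *)
Require Import Defs.
From mathcomp Require Import all_boot.
From mathcomp Require Import ssralg ssrint zify.
From Stdlib Require Import Relations Classical.

(** The proof compares diagrams through an integer, the index.  Call the two
components the first and the second one, colour the plane like a chessboard
along the first, and orient the second.  The index is the number of crossings
at which the second component passes over the first while going from white to
black, minus the number of those at which it does so while going from black to
white.  The colours alternate along the second component, so if the word of its
passages over (o) and under (u) the first component is read cyclically, then
the index is an alternating count of the letters o: up to sign, and up to a
factor, it is the translation length of that word in the infinite dihedral
group generated by the involutions o and u.

A second Reidemeister move inserts or deletes two equal neighbouring letters,
which contribute with opposite signs.  A third Reidemeister move affects the
word only by exchanging two neighbouring letters, and an exchange of equal
letters changes nothing.  If an o is exchanged with a u, then the moving strand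
of the second component lies between two strands of the first, so this is an
RIIIalpha move; the letter o moves by one place, changes its sign, and the
index changes by 2 ([weight_r3]).  The other moves preserve the index, except
that an arc of the first component pushed through infinity exchanges the two
colours and hence the sign of the index ([loses_infinity]).  The absolute value
of the index thus drops by at most 2 in an RIIIalpha move, never drops
otherwise ([loses_directed]), and it is 0 without crossings
([labelling_trivial]).

It remains to find diagrams of the trivial link with a large index.  Let two
strands A and B of a circle cross, A over B, and let them cross back.  Lead a
finger of a second circle around the first of these crossings, at a height
between A and B: its word is ouou, and it contributes 2 to the index
([labelling_block]).  One third move takes the upper side of the finger below
that crossing, and three second moves then remove all the crossings of the
finger and those of A and B ([braided_unlink]).  With n such fingers the index
is 2n.

The index is computed from a labelling of the strands on each horizontal line.
A label tells the component of a strand and, on the second component, the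
direction of travel; the colour on the left of a strand is the parity of the
number of strands of the first component further to the left.  Every event
restricts the labels above and below it and contributes to the index, so the
moves can be studied locally. *)

Set Implicit Arguments.
Unset Strict Implicit.
Unset Printing Implicit Defensive.

Import GRing.Theory.
Local Open Scope ring_scope.

(** * Labelled diagrams and their index *)

Inductive label := First | Second (down : bool).

Definition is_first (a : label) := if a is First then true else false.

Definition reverse (a : label) := if a is Second d then Second (~~ d) else First.

Definition sign (b : bool) : int := if b then -1 else 1.

(** The contribution to the index of a crossing whose strands enter from the upper
left with label [a] and from the upper right with label [c], when [p] is the
parity of the number of strands of the first component to its left.  The two
nonzero cases are those in which the second component is the over-strand; they
differ by the side on which it enters, which decides the colour it comes
from. *)
Definition weight (b p : bool) (a c : label) : int :=
  match a, c with
  | First, Second d => if b then 0 else sign (p (+) d)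
  | Second d, First => if b then sign (~~ p (+) d) else 0
  | _, _ => 0
  end.

(** The labels [s] above an event and [t] below it fit together, with contribution
[z]; the parity of the number of strands of the first component further left
is [p].  A relation is needed, since a maximum does not determine the label of
the arc that it creates.  The recursion on the position [i] removes one strand on
the left at a time, which reduces the study of a move to its leftmost
position. *)
Fixpoint passes (p : bool) (e : event) (i : nat) (s t : seq label) (z : int)
    : Prop :=
  match i, e, s with
  | 0%N, Maximum, _ => exists a, t = [:: a, reverse a & s] /\ z = 0
  | 0%N, Minimum, [:: a, c & s'] => [/\ c = reverse a, t = s' & z = 0]
  | 0%N, Crossing b, [:: a, c & s'] => t = [:: c, a & s'] /\ z = weight b p a c
  | i'.+1, _, a :: s' =>
      exists t', t = a :: t' /\ passes (p (+) is_first a) e i' s' t' z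
  | _, _, _ => False
  end.

Fixpoint labelling (p : bool) (w : seq slice) (s t : seq label) (z : int) : Prop :=
  if w is At e i :: w' then
    exists r z1, passes p e i s r z1 /\ labelling p w' r t (z - z1)
  else s = t /\ z = 0.

Lemma reverseK : involutive reverse.
Proof. by case=> //= d; rewrite negbK. Qed.

Lemma is_first_reverse a : is_first (reverse a) = is_first a.
Proof. by case: a. Qed.

Lemma labelling_cat p u v s t z :
  labelling p (u ++ v) s t z <->
  exists r z1, labelling p u s r z1 /\ labelling p v r t (z - z1).
Proof.
elim: u s z => [|[e i] u IH] s z /=.
  split=> [H|[r [z1 [[<- ->]]]]]; last by rewrite subr0.
  by exists s, 0; rewrite subr0.
split=> [[r [z1 [Hact /IH [r' [z2 [Hu Hv]]]]]]|[r' [z2 [[r [z1 [Hact Hu]]] Hv]]]].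
  exists r', (z1 + z2); split; last by rewrite opprD addrA.
  by exists r, z1; split=> //; rewrite addrAC subrr add0r.
exists r, z1; split=> //; apply/IH; exists r', (z2 - z1); split=> //.
by rewrite opprB addrA subrK.
Qed.

Lemma passes_width p e i s t z : passes p e i s t z ->
  (i + strands_in e <= size s)%N /\
  size t = (size s - strands_in e + strands_out e)%N.
Proof.
elim: i p s t => [|i IH] p [|a s] t //=.
- by case: e => // -[a [-> _]].
- case: e => [|| b]; first by case=> c [-> _] /=; split => //; lia.
    by case: s => //= c s [_ -> _]; split => //; lia.
  by case: s => //= c s [-> _] /=; split => //; lia.
- by case=> t' [-> /IH [Hle Ht]] /=; rewrite Ht; split; lia.
Qed.

Lemma labelling_width p w s t z :
  labelling p w s t z -> width (size s) w = Some (size t).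
Proof.
elim: w s z => [|[e i] w IH] s z /=; first by case=> ->.
by case=> r [z1 [/passes_width [-> Hr] /IH]]; rewrite Hr.
Qed.

Lemma width_cat m u v : width m (u ++ v) = obind (width^~ v) (width m u).
Proof. by elim: u m => [|[e i] u IH] m //=; case: ifP. Qed.

Lemma width_shift m w : width m.+1 (map shift_slice w) = omap S (width m w).
Proof.
elim: w m => [|[e i] w IH] m //=; rewrite addSn ltnS.
by case: ifP => // Hle; rewrite -IH; congr width; lia.
Qed.

(** Moving a word to the right by one strand is compensated by the parity of that
strand. *)
Lemma labelling_shift p a w s t z :
  labelling p (map shift_slice w) (a :: s) t z <->
  exists2 t', t = a :: t' & labelling (p (+) is_first a) w s t' z.
Proof.
elim: w s t z => [|[e i] w IH] s t z /=.
  by split=> [[<- ->]|[t' -> [-> ->]]] //; exists s.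
split=> [[r [z1 [[r' [-> Hact]] /IH [t' -> Hw]]]]|[t' -> [r [z1 [Hact Hw]]]]].
  by exists t' => //; exists r', z1.
exists (a :: r), z1; split; first by exists r.
by apply/IH; exists t'.
Qed.

(** Exchanging the colours reverses every sign. *)
Lemma passes_parity p e i s t z : passes p e i s t z -> passes (~~ p) e i s t (- z).
Proof.
elim: i p s t => [|i IH] p s t /=.
- case: e => [|| b]; first by case=> a [-> ->]; exists a; rewrite oppr0.
    by case: s => [|a [|c s]] //= [-> -> ->]; rewrite oppr0.
  case: s => [|a [|c s]] //= [-> ->]; split=> //.
  by case: a c b p => [|[]] [|[]] [] [].
- case: s => [|a s] // [t' [-> /IH Hact]]; exists t'; split=> //.
  by rewrite addNb.
Qed.

Lemma labelling_parity p w s t z :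
  labelling p w s t z -> labelling (~~ p) w s t (- z).
Proof.
elim: w s z => [|[e i] w IH] s z /=; first by case=> -> ->; rewrite oppr0.
case=> r [z1 [/passes_parity Hact /IH Hw]]; exists r, (- z1); split=> //.
by move: Hw; rewrite opprD.
Qed.

Lemma passes_cat p e i s r t z : (i + strands_in e <= size s)%N ->
  passes p e i (s ++ r) t z <-> exists2 t', t = t' ++ r & passes p e i s t' z.
Proof.
elim: i p s t => [|i IH] p s t Hle /=.
- case: e Hle => [|| b] Hle.
  + split=> [[a [-> ->]]|[t' -> [a [-> ->]]]]; last by exists a.
    by exists [:: a, reverse a & s] => //; exists a.
  + case: s Hle => [|a [|c s]] //= _.
    by split=> [[-> -> ->]|[t' -> [-> -> ->]]] //; exists s.
  + case: s Hle => [|a [|c s]] //= _.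
    by split=> [[-> ->]|[t' -> [-> ->]]] //; exists [:: c, a & s].
- case: s Hle => [|a s] //= Hle.
  split=> [[t' [-> /IH[|t'' -> Hact]]]|[t' -> [t'' [-> Hact]]]]; first by lia.
    by exists (a :: t'') => //; exists t''.
  by exists (t'' ++ r); split=> //; apply/IH; [lia | exists t''].
Qed.

(** The width hypothesis makes the word act on the strands [s] alone, so that the
strands [r] to their right are idle. *)
Lemma labelling_frame p w s r t z : width (size s) w <> None ->
  labelling p w (s ++ r) t z <-> exists2 t', t = t' ++ r & labelling p w s t' z.
Proof.
elim: w s t z => [|[e i] w IH] s t z /=.
  by move=> _; split=> [[<- ->]|[t' -> [-> ->]]] //; exists s.
case: ifP => // Hle Hw.
split=> [[q [z1 [/(passes_cat _ _ _ _ Hle) [q' -> Hact]]]]|].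
  case: (passes_width Hact) => _ Hq; rewrite -Hq in Hw.
  by case/(IH _ _ _ Hw)=> t' -> Hl; exists t' => //; exists q', z1.
case=> t' -> [q [z1 [Hact Hl]]].
exists (q ++ r), z1; split; first by apply/passes_cat => //; exists q.
case: (passes_width Hact) => _ Hq; rewrite -Hq in Hw.
by apply/(IH _ _ _ Hw); exists t'.
Qed.

(** * Local invariance *)

(** Inserting events may require strands that a labelling of the shorter word does
not provide, whence the hypothesis on the width of [y]; in a diagram it holds
automatically. *)
Definition transfers (x y : seq slice) := forall p s t z,
  width (size s) y <> None -> labelling p x s t z -> labelling p y s t z.

Lemma transfers_shift x y :
  transfers x y -> transfers (map shift_slice x) (map shift_slice y).
Proof.
move=> Hxy p [|a s] t z.
  by case: x y Hxy => [|[e i] x] [|[e' i'] y] Hxy //= _ [r [z1 []]].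
rewrite width_shift => Hy /labelling_shift [t' -> Hx]; apply/labelling_shift.
by exists t' => //; apply: Hxy => //; case: width Hy.
Qed.

Definition equivalent x y := transfers x y /\ transfers y x.

Lemma equivalent_shift x y :
  equivalent x y -> equivalent (map shift_slice x) (map shift_slice y).
Proof. by case=> Hxy Hyx; split; apply: transfers_shift. Qed.


Lemma labelling2 p e i e' j s t z :
  labelling p [:: At e i; At e' j] s t z <->
  exists r z1 z2, [/\ passes p e i s r z1, passes p e' j r t z2 & z = z1 + z2].
Proof.
split=> [[r [z1 [H1 [q [z2 [H2 [<- E]]]]]]]|[r [z1 [z2 [H1 H2 ->]]]]].
  exists r, z1, z2; split=> //.
  by apply/eqP; rewrite -subr_eq0 opprD addrA E.
exists r, z1; split=> //; exists t, z2; split=> //; split=> //.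
by rewrite [z1 + z2]addrC addrK subrr.
Qed.

Lemma labelling1 p e i s t z : labelling p [:: At e i] s t z <-> passes p e i s t z.
Proof.
split=> [[r [z1 [H [<- /subr0_eq ->]]]]|H] //.
by exists t, z; rewrite subrr.
Qed.


Arguments labelling : simpl never.

Lemma passes_above p e i x s t z :
  passes p e (size x + i) (x ++ s) t z <->
  exists2 t', t = x ++ t' & passes (p (+) odd (count is_first x)) e i s t' z.
Proof.
elim: x p t => [|a x IH] p t /=.
  by rewrite addbF; split=> [H|[t' ->]] //; exists t.
split=> [[t' [-> /IH [t'' -> Hact]]]|[t' -> Hact]].
  exists t'' => //; move: Hact; rewrite oddD addbA; by case: is_first.
exists (x ++ t'); split=> //; apply/IH; exists t' => //.
by move: Hact; rewrite oddD addbA; case: is_first.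
Qed.

(** An event on the leftmost strands does not see the strands to its right, and its
ends contain the same number, modulo 2, of strands of the first component: so
events further right keep their colours if it changes height. *)
Lemma passes_local p e x q t z : size x = strands_in e ->
  passes p e 0 (x ++ q) t z ->
  exists y, [/\ t = y ++ q, size y = strands_out e,
    odd (count is_first y) = odd (count is_first x)
    & forall q', passes p e 0 (x ++ q') (y ++ q') z].
Proof.
case: e => [|| b] /=.
- case: x => //= _ [a [-> ->]]; exists [:: a; reverse a]; split=> // [|q'].
    by rewrite /= is_first_reverse; case: is_first.
  by exists a.
- case: x => [|a [|c [|? ?]]] //= _ [-> -> ->]; exists [::]; split=> //.
  by rewrite /= is_first_reverse; case: is_first.
- case: x => [|a [|c [|? ?]]] //= _ [-> ->]; exists [:: c; a]; split=> //=.
  by rewrite addnCA.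
Qed.

Lemma exchange_equivalent e i e' j : (i + strands_in e <= j)%N ->
  equivalent [:: At e' j; At e i]
             [:: At e i; At e' (j - strands_in e + strands_out e)].
Proof.
elim: i j => [|i IH] j; last first.
  case: j => // j Hle.
  have Hle' : (i + strands_in e <= j)%N by rewrite -ltnS -addSn.
  have := equivalent_shift (IH _ Hle') => /=.
  suff -> : (j.+1 - strands_in e + strands_out e)%N
            = (j - strands_in e + strands_out e).+1 by [].
  by lia.
rewrite add0n => Hle.
have {Hle} [k ->] : exists k, j = (strands_in e + k)%N.
  by exists (j - strands_in e)%N; rewrite subnKC.
have -> : (strands_in e + k - strands_in e + strands_out e)%N = (strands_out e + k)%N.
  by lia.
have split_in s : (strands_in e <= size s)%N ->
    exists x q, s = x ++ q /\ size x = strands_in e.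
  move=> Hs; exists (take (strands_in e) s), (drop (strands_in e) s).
  by rewrite cat_take_drop size_takel.
split=> p s t z _ /labelling2 [r [z1 [z2 [H1 H2 ->]]]]; apply/labelling2.
  have [x [q [Es Ex]]] : exists x q, s = x ++ q /\ size x = strands_in e.
    by apply: split_in; case: (passes_width H1); lia.
  move: H1; rewrite Es -Ex => /passes_above [q' Er H1].
  move: H2; rewrite Er => /(passes_local Ex) [y [-> Ey Hxy He]].
  exists (y ++ q), z2, z1; split=> //; last by rewrite addrC.
  by rewrite -Ey; apply/passes_above; exists q' => //; rewrite Hxy.
have [x [q [Es Ex]]] : exists x q, s = x ++ q /\ size x = strands_in e.
  by apply: split_in; case: (passes_width H1); lia.
move: H1; rewrite Es => /(passes_local Ex) [y [Er Ey Hxy He]].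
move: H2; rewrite Er -Ey => /passes_above [q' -> H2].
exists (x ++ q'), z2, z1; split=> //; last by rewrite addrC.
by rewrite -Ex; apply/passes_above; exists q' => //; rewrite -Hxy.
Qed.

(** When a strand turns at a crossing, the crossing moves to the other side of the
turning arc and the travel direction seen at it is reversed.  If the turning
arc belongs to the first component, then the colour seen there changes;
otherwise the direction changes.  As the two strands also exchange the sides from
which they enter, the contribution is the same in both cases. *)
Lemma isotopy_equivalent x y : planar_isotopy x y -> equivalent x y.
Proof.
case=> [e i e' j|i|i|b i|b i]; first exact: exchange_equivalent.
- elim: i => [|i /equivalent_shift //]; split=> p s t z.
    move=> _ /labelling2 [r [z1 [z2 [[a [-> ->]]]]]] /=.
    by case: s => [|c s] [t' [-> []]] // -> -> -> ->; rewrite reverseK.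
  case: s => [|a s] //= _ [<- ->]; apply/labelling2.
  exists [:: a, reverse a, a & s], 0, 0; split=> //; first by exists a.
  by exists s; rewrite /= reverseK.
- elim: i => [|i /equivalent_shift //]; split=> p s t z.
    move=> _ /labelling2 [r [z1 [z2 []]]].
    case: s => [|c s] //= [t' [-> [a [-> ->]]]] [-> -> ->] ->.
    by rewrite reverseK.
  case: s => [|a s] //= _ [<- ->]; apply/labelling2.
  exists [:: a, reverse a, a & s], 0, 0; split=> //; exists [:: reverse a, a & s].
  by split=> //; exists (reverse a); rewrite /= reverseK.
- elim: i => [|i /equivalent_shift //]; split=> p s t z.
    move=> _ /labelling2 [r [z1 [z2 [[a [-> ->]]]]]] /=.
    case: s => [|c s] [t' [-> []]] // -> -> ->; apply/labelling2.
    exists [:: c, a, reverse a & s], 0, (weight (~~ b) p c a); split=> //.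
      by exists [:: a, reverse a & s]; split=> //; exists a.
    by case: a c b p => [|[]] [|[]] [] [].
  move=> _ /labelling2 [r [z1 [z2 []]]].
  case: s => [|c s] //= [t' [-> [a [-> ->]]]] [-> ->] ->; apply/labelling2.
  exists [:: a, reverse a, c & s], 0, (weight b (p (+) is_first a) (reverse a) c).
  split; first by exists a.
    by exists [:: c, reverse a & s].
  by case: a c b p => [|[]] [|[]] [] [].
- elim: i => [|i /equivalent_shift //]; split=> p s t z.
    move=> _ /labelling2 [r [z1 [z2 []]]].
    case: s => [|a [|c [|d s]]] //= [t' [-> //]].
    case=> -> -> [E -> ->] ->; apply/labelling2.
    exists [:: c, a, d & s], (weight (~~ b) p a c), 0; split=> //.
      by exists s.
    by rewrite E; case: a c b p {E} => [|[]] [|[]] [] [].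
  move=> _ /labelling2 [r [z1 [z2 []]]].
  case: s => [|a [|c s]] //= [-> ->].
  case: s => [|d s] /= [t' [-> //]] [E -> ->] ->; apply/labelling2.
  exists [:: a, d, c & s], (weight b (p (+) is_first a) c d), 0; split=> //.
    by exists [:: d, c & s].
  by rewrite E; case: a c b p {E} => [|[]] [|[]] [] [].
Qed.

Lemma r1_equivalent x y : reidemeister1 x y -> equivalent x y.
Proof.
case=> b i; elim: i => [|i /equivalent_shift //]; split=> p s t z.
- move=> _ /labelling2 [r [z1 [z2 [[a [-> ->]] [-> ->] ->]]]]; apply/labelling1.
  exists (reverse a); rewrite reverseK; split=> //.
  by case: a b p => [|[]] [] [].
- move=> _ /labelling1 [a [-> ->]]; apply/labelling2.
  exists [:: reverse a, a & s], 0, 0; split=> //; first by exists (reverse a); rewrite reverseK.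
  by split=> //; case: a b p => [|[]] [] [].
- move=> _ /labelling2 [r [z1 [z2 []]]].
  case: s => [|a [|c s]] //= [-> ->] [-> -> ->] ->; apply/labelling1.
  by split; rewrite ?reverseK //; case: c b p => [|[]] [] [].
- move=> _ /labelling1; case: s => [|a [|c s]] //= [-> -> ->]; apply/labelling2.
  exists [:: reverse a, a & s], 0, 0; split=> //.
    by split=> //; case: a b p => [|[]] [] [].
  by split; rewrite ?reverseK.
Qed.

Lemma r2_equivalent x y : reidemeister2 x y -> equivalent x y.
Proof.
case=> b i; elim: i => [|i /equivalent_shift //]; split=> p s t z.
  move=> _ /labelling2 [r [z1 [z2 []]]].
  case: s => [|a [|c s]] //= [-> ->] [-> ->] ->; split=> //.
  by case: a c b p => [|[]] [|[]] [] [].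
case: s => [|a [|c s]] //= _ [<- ->]; apply/labelling2.
exists [:: c, a & s], (weight b p a c), (weight (~~ b) p c a); split=> //.
by case: a c b p => [|[]] [|[]] [] [].
Qed.

Lemma labelling_r3_before b1 b2 b3 p s t z :
  labelling p [:: At (Crossing b1) 0; At (Crossing b2) 1; At (Crossing b3) 0] s t z
  <-> exists a0 a1 a2 q,
    [/\ s = [:: a0, a1, a2 & q], t = [:: a2, a1, a0 & q]
      & z = weight b1 p a0 a1 + weight b2 (p (+) is_first a1) a0 a2
            + weight b3 p a1 a2].
Proof.
split=> [[r [z1 []]]|[a0 [a1 [a2 [q [-> -> ->]]]]]].
  case: s => [|a0 [|a1 s]] //= [-> ->] [r' [z2 []]].
  case: s => [|a2 q] /= [t' [-> //]] [-> ->] [t'' [z3 [[-> ->]]]] [<- E].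
  exists a0, a1, a2, q; split=> //; apply/eqP; rewrite -subr_eq0 -E.
  by rewrite !opprD !addrA.
eexists; eexists; split; first by split; reflexivity.
eexists; eexists; split; first by eexists; split; [|split]; reflexivity.
eexists; eexists; split; first by split; reflexivity.
by split=> //; lia.
Qed.

Lemma labelling_r3_after b1 b2 b3 p s t z :
  labelling p [:: At (Crossing b1) 1; At (Crossing b2) 0; At (Crossing b3) 1] s t z
  <-> exists a0 a1 a2 q,
    [/\ s = [:: a0, a1, a2 & q], t = [:: a2, a1, a0 & q]
      & z = weight b1 (p (+) is_first a0) a1 a2 + weight b2 p a0 a2
            + weight b3 (p (+) is_first a2) a0 a1].
Proof.
split=> [[r [z1 []]]|[a0 [a1 [a2 [q [-> -> ->]]]]]].
  case: s => [|a0 [|a1 [|a2 q]]] //= [t' [-> //]].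
  case=> -> -> [r' [z2 [[-> ->]]]] [t'' [z3 [[q' [-> [-> ->]]] [<- E]]]].
  exists a0, a1, a2, q; split=> //; apply/eqP; rewrite -subr_eq0 -E.
  by rewrite !opprD !addrA.
eexists; eexists; split; first by eexists; split; [|split]; reflexivity.
eexists; eexists; split; first by split; reflexivity.
eexists; eexists; split; first by eexists; split; [|split]; reflexivity.
by split=> //; lia.
Qed.

Definition distinct_at (s : seq label) j k :=
  is_first (nth First s j) != is_first (nth First s k).

(** What a third move does to a labelling: the index is kept unless the labels show
that the middle strand belongs to another component than the upper and the
lower one. *)
Definition r3_related (x y : seq slice) i upper middle lower :=
  forall p s t z, labelling p x s t z ->
  exists2 z', labelling p y s t z' &
    z' = z \/ [/\ distinct_at s (i + upper) (i + middle),
                  distinct_at s (i + middle) (i + lower)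
                & (`|z - z'| <= 2)%N].

Lemma r3_related_shift e j e' j' x y i upper middle lower :
  r3_related (At e j :: x) (At e' j' :: y) i upper middle lower ->
  r3_related (map shift_slice (At e j :: x)) (map shift_slice (At e' j' :: y))
             i.+1 upper middle lower.
Proof.
move=> H p [|a s] t z; first by case=> r [z1 []].
case/labelling_shift=> t' -> /H [z' Hy Hz]; exists z' => //.
by apply/labelling_shift; exists t'.
Qed.

(** The heart of the argument, a finite computation: of the labels of the three
strands, only first-second-first in the order of heights lets the sum of the
contributions change. *)
Lemma weight_r3 upper middle lower (h := [:: upper; middle; lower]) p a0 a1 a2 :
  perm_eq h [:: 0; 1; 2]%N ->
  let before := weight (above h 0 1) p a0 a1
                + weight (above h 0 2) (p (+) is_first a1) a0 a2
                + weight (above h 1 2) p a1 a2 in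
  let after := weight (above h 1 2) (p (+) is_first a0) a1 a2
               + weight (above h 0 2) p a0 a2
               + weight (above h 0 1) (p (+) is_first a2) a0 a1 in
  before = after \/
  [/\ distinct_at [:: a0; a1; a2] upper middle,
      distinct_at [:: a0; a1; a2] middle lower,
      (`|before - after| <= 2)%N & (`|after - before| <= 2)%N].
Proof.
rewrite -mem_permutations; set l := permutations _; vm_compute in l.
rewrite {}/l !inE {}/h.
do ?[case/orP]; move=> /eqP [-> -> ->];
  case: a0 a1 a2 p => [|[]] [|[]] [|[]] [];
  solve [by left | by right].
Qed.

Lemma r3_labelling upper middle lower (h := [:: upper; middle; lower]) i :
  perm_eq h [:: 0; 1; 2]%N ->
  r3_related (r3_before h i) (r3_after h i) i upper middle lower /\
  r3_related (r3_after h i) (r3_before h i) i upper middle lower.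
Proof.
move=> Hh; elim: i => [|i [IH1 IH2]]; last first.
  by split; [exact: r3_related_shift IH1 | exact: r3_related_shift IH2].
have Hlt : (upper < 3)%N && ((middle < 3) && (lower < 3))%N.
  have : all (gtn 3) h by rewrite (perm_all _ Hh).
  by rewrite /= andbT.
case/and3P: Hlt => Hu Hm Hl.
have dist (a0 a1 a2 : label) q j k : (j < 3)%N -> (k < 3)%N ->
    distinct_at [:: a0, a1, a2 & q] j k = distinct_at [:: a0; a1; a2] j k.
  by case: j => [|[|[|]]] //; case: k => [|[|[|]]].
split=> p s t z.
  case/labelling_r3_before=> a0 [a1 [a2 [q [-> -> ->]]]].
  eexists; first by apply/labelling_r3_after; exists a0, a1, a2, q; split; reflexivity.
  rewrite !add0n !dist //.
  by case: (weight_r3 p a0 a1 a2 Hh) => [|[]]; [left | right].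
case/labelling_r3_after=> a0 [a1 [a2 [q [-> -> ->]]]].
eexists; first by apply/labelling_r3_before; exists a0, a1, a2, q; split; reflexivity.
rewrite !add0n !dist //.
by case: (weight_r3 p a0 a1 a2 Hh) => [|[]]; [left | right].
Qed.

(** * Labels are constant along components *)

Lemma passes_arcs p e i s t z (lab := fun r j => is_first (nth First r j)) :
  passes p e i s t z ->
  [/\ forall j, (j < i)%N -> lab s j = lab t j,
      forall j, (i + strands_in e <= j)%N ->
        lab s j = lab t (j - strands_in e + strands_out e)%N
    & match e with
      | Maximum => lab t i = lab t i.+1
      | Minimum => lab s i = lab s i.+1
      | Crossing _ => lab s i = lab t i.+1 /\ lab s i.+1 = lab t i
      end].
Proof.
rewrite /lab; elim: i p s t => [|i IH] p s t.
- case: e => [|| b] /=.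
  + case=> a [-> _]; split=> // [j _|]; first by rewrite subn0 addn2.
    by rewrite /= is_first_reverse.
  + case: s => [|a [|c s]] //= [-> -> _]; split=> // [[|[|j]] // _|].
      by rewrite addn0 !subSS subn0.
    by rewrite is_first_reverse.
  + case: s => [|a [|c s]] //= [-> _]; split=> // -[|[|j]] // _.
    by rewrite !subSS subn0 addn2.
- case: s => [|a s] //= [t' [-> /IH [Hl Hr He]]]; split.
  + by case=> // j /Hl.
  + case=> // j Hj; rewrite /= Hr; last by lia.
    by have -> : (j.+1 - strands_in e + strands_out e
      = (j - strands_in e + strands_out e).+1)%N by lia.
  + by case: e {IH Hr Hl} He.
Qed.

Lemma arc_cons e i w p q : Defs.arc (At e i :: w) p q ->
  [\/ [/\ (p.2 < i)%N, p.1 = 0%N & q = (1, p.2)%N],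
      [/\ (i + strands_in e <= p.2)%N, p.1 = 0%N
        & q = (1, p.2 - strands_in e + strands_out e)%N],
      match e with
      | Maximum => p = (1, i)%N /\ q = (1, i.+1)%N
      | Minimum => p = (0, i)%N /\ q = (0, i.+1)%N
      | Crossing _ => p = (0, i)%N /\ q = (1, i.+1)%N \/
                      p = (0, i.+1)%N /\ q = (1, i)%N
      end
    | exists k j k' j', [/\ p = (k.+1, j), q = (k'.+1, j') & Defs.arc w (k, j) (k', j')]].
Proof.
case=> [[|k] e' i' j|[|k] e' i' j|[|k] i'|[|k] i'|[|k] b i'|[|k] b i'] /=;
  try (case=> -> ->).
- by move=> Hj; constructor 1.
- by move=> Hk Hj; constructor 4; exists k, j, k.+1, j; split=> //; apply: arc_left Hk Hj.
- by move=> Hj; constructor 2.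
- move=> Hk Hj; constructor 4; do 4 eexists; split; try reflexivity.
  exact: arc_right Hk Hj.
- by constructor 3.
- by move=> Hk; constructor 4; do 4 eexists; split; try reflexivity; apply: arc_maximum.
- by constructor 3.
- by move=> Hk; constructor 4; do 4 eexists; split; try reflexivity; apply: arc_minimum.
- by constructor 3; left.
- move=> Hk; constructor 4; do 4 eexists; split; try reflexivity; exact: arc_falling Hk.
- by constructor 3; right.
- move=> Hk; constructor 4; do 4 eexists; split; try reflexivity; exact: arc_rising Hk.
Qed.

Lemma labelling_points p u v s r t z1 z2 :
  labelling p u s r z1 -> labelling p v r t z2 ->
  exists lab : point -> bool,
    [/\ forall a b, Defs.arc (u ++ v) a b -> lab a = lab b,
        forall j, lab (0%N, j) = is_first (nth First s j)
      & forall j, lab (size u, j) = is_first (nth First r j)].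
Proof.
have extend e i w s' r' z (lab : point -> bool) : passes p e i s' r' z ->
    (forall a b, Defs.arc w a b -> lab a = lab b) ->
    (forall j, lab (0%N, j) = is_first (nth First r' j)) ->
    exists lab' : point -> bool,
    [/\ forall a b, Defs.arc (At e i :: w) a b -> lab' a = lab' b,
        forall j, lab' (0%N, j) = is_first (nth First s' j)
      & forall k j, lab' (k.+1, j) = lab (k, j)].
  move=> /passes_arcs [Hl Hr He] Hw H0.
  exists (fun a => if a.1 is k.+1 then lab (k, a.2) else is_first (nth First s' a.2)).
  split=> // -[k j] [k' j'] /arc_cons
    [[/= Hj -> [-> ->]]|[/= Hj -> [-> ->]]|H|[k1 [j1 [k2 [j2 [[-> ->] [-> ->] /Hw]]]]]] //=.
  - by rewrite H0 Hl.
  - by rewrite H0 Hr.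
  - case: e He H {Hl Hr} => [|| b] He; first by case=> [[-> ->] [-> ->]]; rewrite !H0.
      by case=> [[-> ->] [-> ->]].
    by case: He => He1 He2; case=> [[[-> ->] [-> ->]]|[[-> ->] [-> ->]]]; rewrite H0.
elim: u s z1 => [|[e i] u IH] s z1.
  case=> -> _; elim: v r z2 => [|[e i] v IH] r z2.
    case=> -> _; exists (fun a => is_first (nth First t a.2)); split=> // a b.
    by case=> >; rewrite onth0n.
  case=> r' [z [Hact /IH [lab [Hw H0 _]]]].
  by have [lab' [Hw' H0' _]] := extend _ _ _ _ _ _ _ Hact Hw H0; exists lab'.
case=> r' [z [Hact Hu]] Hv; have [lab [Hw H0 Hr]] := IH _ _ Hu Hv.
have [lab' [Hw' H0' HS]] := extend _ _ _ _ _ _ _ Hact Hw H0.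
by exists lab'; split=> // j; rewrite /= HS.
Qed.

Lemma distinct_components p u v s r t z1 z2 j k :
  labelling p u s r z1 -> labelling p v r t z2 -> distinct_at r j k ->
  ~ same_component (u ++ v) (size u, j) (size u, k).
Proof.
move=> Hu Hv /eqP Hjk; have [lab [Hw _ Hr]] := labelling_points Hu Hv.
move=> Hc; apply: Hjk; rewrite -!Hr.
by elim: Hc => // a b c _ -> _ ->.
Qed.

(** * The effect of a move on the index *)

(** The index is compared through labellings that can be carried from [w] to [w'],
so that no canonical choice of a labelling is needed. *)
Definition loses_at_most c w w' := forall z, labelling false w [::] [::] z ->
  exists2 z', labelling false w' [::] [::] z' & (`|z| <= `|z'| + c)%N.

Lemma loses_context c u v x y : width 0 (u ++ y ++ v) <> None ->
  (forall s r z0 z z2, labelling false u [::] s z0 -> labelling false v r [::] z2 ->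
     width (size s) y <> None -> labelling false x s r z ->
     exists2 z', labelling false y s r z' & (`|z - z'| <= c)%N) ->
  loses_at_most c (u ++ x ++ v) (u ++ y ++ v).
Proof.
move=> Hw H z /labelling_cat [s [z0 [Hu /labelling_cat [r [z1 [Hx Hv]]]]]].
have Hy : width (size s) y <> None.
  move: Hw; rewrite width_cat (labelling_width Hu) /= width_cat.
  by case: width.
have [z1' Hy' Hz] := H _ _ _ _ _ Hu Hv Hy Hx.
exists (z + (z1' - z1)); last by lia.
apply/labelling_cat; exists s, z0; split=> //.
apply/labelling_cat; exists r, z1'; split=> //.
by have -> : z + (z1' - z1) - z0 - z1' = z - z0 - z1 by lia.
Qed.

Lemma loses_transfers u v x y : width 0 (u ++ y ++ v) <> None ->
  transfers x y -> loses_at_most 0 (u ++ x ++ v) (u ++ y ++ v).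
Proof.
move=> Hw Hxy; apply: loses_context => // s r z0 z z2 _ _ Hy /(Hxy _ _ _ _ Hy).
by exists z => //; rewrite subrr.
Qed.

(** If the index changes, the labels themselves prove the condition of an RIIIalpha
move; whether the components of the strands really differ never has to be
decided. *)
Lemma loses_r3 c u v upper middle lower (h := [:: upper; middle; lower]) i
  (w := u ++ r3_before h i ++ v) (w' := u ++ r3_after h i ++ v) :
  perm_eq h [:: 0; 1; 2]%N ->
  (alpha_condition w (size u) i upper middle lower -> c = 2) ->
  width 0 w <> None -> width 0 w' <> None -> loses_at_most c w w' /\ loses_at_most c w' w.
Proof.
move=> Hh Hc Hw Hw'; have [Hba Hab] := r3_labelling i Hh.
have alpha s r z0 z z2 : labelling false u [::] s z0 ->
    labelling false (r3_before h i) s r z -> labelling false v r [::] z2 ->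
    distinct_at s (i + upper) (i + middle) ->
    distinct_at s (i + middle) (i + lower) -> c = 2.
  move=> Hu Hx Hv Hum Hml; apply: Hc; have Hxv :
      labelling false (r3_before h i ++ v) s [::] (z + z2).
    apply/labelling_cat; exists r, z; split=> //.
    by rewrite addrAC subrr add0r.
  by split; apply: distinct_components Hu Hxv _.
split; apply: loses_context => // s r z0 z z2 Hu Hv _ Hx.
  have [z' Hz' Hd] := Hba _ _ _ _ Hx; exists z' => //.
  case: Hd => [->|[Hum Hml Hd]]; first by rewrite subrr.
  by rewrite (alpha _ _ _ _ _ Hu Hx Hv Hum Hml).
have [z' Hz' Hd] := Hab _ _ _ _ Hx; exists z' => //.
case: Hd => [->|[Hum Hml Hd]]; first by rewrite subrr.
by rewrite (alpha _ _ _ _ _ Hu Hz' Hv Hum Hml).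
Qed.


Lemma labelling_closure w z :
  labelling false (At Maximum 0 :: w ++ [:: At Minimum 0]) [::] [::] z <->
  exists a b, labelling false w [:: a; reverse a] [:: b; reverse b] z.
Proof.
split=> [[_ [_ [[a [-> ->]]]]]|[a [b Hw]]].
  case/labelling_cat=> r [z1 [Hw /labelling1]].
  case: r Hw => [|b [|c r]] //= Hw [Ec Er /subr0_eq Ez].
  exists a, b; move: Hw; rewrite -Ec -Er -Ez.
  by rewrite subr0.
exists [:: a; reverse a], 0; split; first by exists a.
apply/labelling_cat; exists [:: b; reverse b], z; split=> //.
by apply/labelling1; rewrite subr0 subrr.
Qed.

(** The outer arc that passes through infinity starts on the left of [w] and ends on
its right.  If it belongs to the first component, then all the colours in [w]
are exchanged, and the index changes sign. *)
Lemma loses_infinity w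
    (x := At Maximum 0 :: map shift_slice w ++ [:: At Minimum 0])
    (y := At Maximum 0 :: w ++ [:: At Minimum 0]) :
  width 1 w = Some 1%N -> loses_at_most 0 x y /\ loses_at_most 0 y x.
Proof.
move=> Hw.
have Hw' a : width (size [:: a : label]) w <> None by rewrite Hw.
have flip p q s t z : labelling p w s t z ->
    exists2 z', labelling q w s t z' & absz z' = absz z.
  move=> H; have := labelling_parity H.
  case: (eqVneq q p) => [-> _|Hq Hn]; first by exists z.
  exists (- z); last by rewrite abszN.
  by have -> : q = ~~ p by case: p q Hq {H Hn} => [] [].
split=> z /labelling_closure [a [b H]].
  case/labelling_shift: H => _ [-> <-] /(flip _ false) [z' Hl Hz].
  exists z'; last by rewrite Hz addn0.
  apply/labelling_closure; exists (reverse a), (reverse a).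
  by apply/(labelling_frame _ [:: _] _ _ (Hw' _)); exists [:: reverse a].
case/(labelling_frame _ [:: _] _ _ (Hw' _)): H => -[|c [|d r]] //=;
  last by case=> _ _; case: r.
case=> <- /(inv_inj reverseK) <-.
move=> /(flip _ (is_first (reverse b))) [z' Hl Hz].
exists z'; last by rewrite Hz addn0.
apply/labelling_closure; exists (reverse b), (reverse b); rewrite reverseK.
by apply/labelling_shift; exists [:: b].
Qed.

Lemma loses_trans c d w1 w2 w3 :
  loses_at_most c w1 w2 -> loses_at_most d w2 w3 -> loses_at_most (c + d) w1 w3.
Proof.
move=> H12 H23 z /H12 [z' /H23 [z'' H3 Hz'] Hz]; exists z'' => //.
by lia.
Qed.

Lemma loses_directed S t w w' : directed_move S t w w' ->
  width 0 w = Some 0%N -> width 0 w' = Some 0%N ->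
  loses_at_most (2 * is_RIIIalpha t) w w' /\ loses_at_most (2 * is_RIIIalpha t) w' w.
Proof.
case=> [u v x y /isotopy_equivalent Hxy|w0 _ Hw|u v x y /r1_equivalent Hxy|
        u v x y /r2_equivalent Hxy|u v i up mid low h Hh Ha|u v i up mid low h Hh Ha]
  Hw1 Hw2; rewrite ?muln0 ?muln1.
- by case: Hxy => Hxy Hyx; split; apply: loses_transfers; rewrite ?Hw1 ?Hw2.
- exact: loses_infinity.
- by case: Hxy => Hxy Hyx; split; apply: loses_transfers; rewrite ?Hw1 ?Hw2.
- by case: Hxy => Hxy Hyx; split; apply: loses_transfers; rewrite ?Hw1 ?Hw2.
- by apply: loses_r3; rewrite ?Hw1 ?Hw2.
- by apply: loses_r3; rewrite ?Hw1 ?Hw2.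
Qed.

Lemma loses_transforms S D ts E : transforms S D ts E ->
  loses_at_most (2 * count is_RIIIalpha ts) D E.
Proof.
elim=> [{}D|{}D t D' {}ts {}E Ht _ IH].
  by rewrite muln0 => z Hz; exists z; rewrite ?addn0.
rewrite /= mulnDr; apply: loses_trans IH.
case: Ht => Ht; [case: (loses_directed Ht) | case: (loses_directed Ht)] => //;
  exact: closed_slices.
Qed.

Lemma labelling_trivial p w s t z :
  ~~ has is_crossing w -> labelling p w s t z -> z = 0.
Proof.
elim: w s z => [|[e i] w IH] s z; first by move=> _ [].
rewrite /= negb_or => /andP[He Hw] [r [z1 [Hact /(IH _ _ Hw)]]] /subr0_eq ->.
elim: i p s r Hact {IH} => [|i IH] p s r.
  case: e He => //= _; first by case=> a [].
  by case: s => [|a [|c s]] // [].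
by case: s => [|a s] // [t' [_ /IH]].
Qed.

(** * Diagrams of large index *)

(** Going upwards along a strand, one can only stop at a maximum. *)
Lemma connected_to_maximum w p : width 0 w = Some 0%N -> is_point w p ->
  exists k i, onth w k = Some (At Maximum i) /\ same_component w p (k.+1, i).
Proof.
case: p => k j Hw; elim: k j => [|k IH] j [m /=]; first by rewrite take0 => -[<-].
case E: (onth w k) => [[e i]|] Hm Hj; last first.
  have Hk : (size w <= k)%N by rewrite -onthNE E.
  by move: Hm Hj; rewrite take_oversize ?Hw => [[<-]|] //; apply: leqW.
have Hk : (k < size w)%N by rewrite -onthTE E.
move: Hm; rewrite (take_nth (At e i)) // (onth_nth _ _ _ _ E) -cats1 width_cat.
case Em : (width 0 (take k w)) => [m0|] //=; case: ifP => // Hi [Hm].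
have lift j' : (j' < m0)%N -> same_component w (k, j') (k.+1, j) ->
    exists k' i', onth w k' = Some (At Maximum i') /\
                  same_component w (k.+1, j) (k'.+1, i').
  move=> Hj' Hjj'; have [|k' [i' [Hk' Hc]]] := IH j'; first by exists m0.
  exists k', i'; split=> //; apply: rst_trans Hc; exact: rst_sym.
case: (ltnP j i) => [Hji|Hij].
  by apply: (lift j); [lia | apply: rst_step; apply: arc_left E _].
case: (ltnP j (i + strands_out e)) => [Hjo|Hoj]; last first.
  apply: (lift (j - strands_out e + strands_in e)%N); first by lia.
  have {2}-> : j = (j - strands_out e + strands_in e - strands_in e
                    + strands_out e)%N by lia.
  by apply: rst_step; apply: arc_right E _; lia.
case: e E Hi Hm Hjo lift => [|| b] /= E Hi Hm Hjo lift; last 2 first.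
- by lia.
- have [Ej|Ej] : j = i \/ j = i.+1 by lia.
    by apply: (lift i.+1); [lia | rewrite Ej; apply: rst_step; apply: arc_rising E].
  by apply: (lift i); [lia | rewrite Ej; apply: rst_step; apply: arc_falling E].
exists k, i; split=> //; have [->|->] : j = i \/ j = i.+1 by lia.
  exact: rst_refl.
by apply: rst_sym; apply: rst_step; apply: arc_maximum.
Qed.

(** One finger.  The strands 0 and 1 above it are A and B, which pass over and under
the finger L, strand 2: L crosses B and then A to the left, A and B cross,
L returns to the right across B and then A, and A and B cross back. *)
Definition block :=
  [:: At (Crossing false) 1; At (Crossing true) 0; At (Crossing true) 1;
      At (Crossing true) 0; At (Crossing false) 1; At (Crossing false) 0].

Definition two_maxima := [:: At Maximum 0; At Maximum 2].

Definition blocks n := flatten (nseq n block) ++ [:: At Minimum 2; At Minimum 0].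

Lemma width_blocks n : width 4 (blocks n) = Some 0%N.
Proof. by elim: n. Qed.

Definition braided n : diagram := @Diagram (two_maxima ++ blocks n) (width_blocks n).

(** Once the upper side of a finger lies below the crossing of A and B, next to its
lower side, all the crossings cancel in pairs, from the inside outwards. *)
Lemma braided_unlink S n : same_link S (braided n) (braided 0).
Proof.
elim: n => [|n [ts IH]]; first by exists [::]; constructor.
set v := [:: At (Crossing true) 0; At (Crossing false) 1; At (Crossing false) 0]
         ++ blocks n.
have W := width_blocks n.
pose E1 := @Diagram (two_maxima ++ r3_before [:: 0; 2; 1]%N 0 ++ v) W.
pose E2 := @Diagram (two_maxima ++ [:: At (Crossing true) 0; At (Crossing true) 1;
  At (Crossing false) 1; At (Crossing false) 0] ++ blocks n) W.
pose E3 := @Diagram (two_maxima ++ [:: At (Crossing true) 0; At (Crossing false) 0]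
  ++ blocks n) W.
have [t M1] : exists t, directed_move S t E1 (braided n.+1).
  (* The type of this move depends on the components of the whole diagram, but
     any type will do. *)
  have [Ha|Ha] := classic (alpha_condition E1 (size two_maxima) 0 0 2 1).
    by exists RIIIalpha; apply: (@move_RIIIalpha S two_maxima v 0 0 2 1).
  by exists RIIIother; apply: (@move_RIIIother S two_maxima v 0 0 2 1).
have M2 : directed_move S RII E1 E2.
  exact: (@move_RII S (two_maxima ++ [:: At (Crossing true) 0; At (Crossing true) 1])
    ([:: At (Crossing false) 1; At (Crossing false) 0] ++ blocks n) _ _ (r2 false 0)).
have M3 : directed_move S RII E2 E3.
  exact: (@move_RII S (two_maxima ++ [:: At (Crossing true) 0])
    (At (Crossing false) 0 :: blocks n) _ _ (r2 true 1)).
have M4 : directed_move S RII E3 (braided n).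
  exact: (@move_RII S two_maxima (blocks n) _ _ (r2 true 0)).
exists [:: t, RII, RII, RII & ts].
apply: transforms_cons (or_intror M1) _.
apply: transforms_cons (or_introl M2) _.
apply: transforms_cons (or_introl M3) _.
exact: transforms_cons (or_introl M4) IH.
Qed.

Definition block_labels := [:: First; First; Second true; Second false].

(** L passes over B once in each half of the finger.  The first passage starts to the
right of A and B, the second to the left of both; these regions have the same
colour, so both passages contribute 1. *)
Lemma labelling_block : labelling false block block_labels block_labels 2.
Proof.
apply/(labelling_cat _ (take 3 block) (drop 3 block)).
exists [:: Second true; First; First; Second false], 1; split.
  by apply/labelling_r3_after; exists First, First, (Second true), [:: Second false].
by apply/labelling_r3_before; exists (Second true), First, First, [:: Second false].
Qed.

Lemma labelling_blocks n : labelling false (blocks n) block_labels [::] (n.*2)%:Z.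
Proof.
elim: n => [|n IH].
  apply/labelling2; exists [:: First; First], 0, 0; split=> //.
  by exists [:: First]; split=> //; exists [::].
rewrite /blocks /= -/block. 
apply/(labelling_cat _ block (blocks n)); exists block_labels, 2.
split; first exact: labelling_block.
by have -> : (n.+1.*2)%:Z - 2 = (n.*2)%:Z by lia.
Qed.

Lemma labelling_two_maxima : labelling false two_maxima [::] block_labels 0.
Proof.
apply/labelling2; exists [:: First; First], 0, 0; split=> //; first by exists First.
by exists [:: First; Second true; Second false]; split=> //;
  exists [:: Second true; Second false]; split=> //; exists (Second true).
Qed.

Lemma braided_maxima n k i :
  onth (braided n) k = Some (At Maximum i) -> (k, i) = (0, 0)%N \/ (k, i) = (1, 2)%N.
Proof.
case: k => [|[|k]] /=; [by case=> <-; left | by case=> <-; right | move=> H].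
pose descending s := if s is At Maximum _ then false else true.
have : all descending (blocks n) by elim: n {H}.
move/(all_nthP (At Maximum i))/(_ k); rewrite (onth_nth _ _ _ _ H).
by rewrite -onthTE H => /(_ isT).
Qed.

Lemma braided_components n : has_components (braided n) 2.
Proof.
have Hd : ~ same_component (braided n) (2, 0)%N (2, 2)%N.
  exact: distinct_components labelling_two_maxima (labelling_blocks n) _.
exists (fun a : 'I_2 => (2, a.*2)%N); split.
- by move=> a; exists 4%N; [rewrite /= take0 | case: a => [[|[|]]]].
- move=> [[|[|a]] Ha] [[|[|b]] Hb] //= Hab; apply: val_inj => //=.
  by case: Hd; apply: rst_sym.
- move=> p /(connected_to_maximum (closed_slices _)) [k [i [/braided_maxima Hk Hp]]].
  case: Hk => -[Ek Ei]; move: Hp; rewrite Ek Ei => Hp; [exists ord0 | exists ord_max] => //.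
  apply: rst_trans Hp _; apply: rst_step.
  exact: (@arc_left _ 1 Maximum 2 0).
Qed.

Close Scope ring_scope.

Theorem theorem4 (S : surface) (n : nat) (hn : 1 <= n) :
  exists D : diagram,
    [/\ has_components D 2,
        trivial_link S D
      & forall (ts : seq move_type) (E : diagram),
          transforms S D ts E -> trivial_diagram E ->
          n <= count is_RIIIalpha ts].
Proof.
exists (braided n); split; first exact: braided_components.
  by exists (braided 0) => //; apply: braided_unlink.
move=> ts E Hts HE.
have Hz : labelling false (braided n) [::] [::] (n.*2)%:Z.
  apply/labelling_cat; exists block_labels, 0; split; first exact: labelling_two_maxima.
  by rewrite subr0; apply: labelling_blocks.
have [z /(labelling_trivial HE) -> Hn] := loses_transforms Hts Hz.
by move: Hn; rewrite add0n mul2n leq_double.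
Qed.
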